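(* A sign pattern is canonical if and only if it contains none of the configurations $$A=(+,+,-,-),\quad B=(-,-,+,+),\quad C=(+,-,-,+),\quad D=(-,+,+,-),$$ that is, if and only if no four consecutive components of the sign pattern form one of the quadruples $A$, $B$, $C$, $D$.
   Context: A sign pattern of length $d+1$ ($d\ge 1$) is a sequence of $d+1$ signs $+$ and/or $-$. A real polynomial $Q=\sum_{j=0}^d a_jx^j$ with all $a_j\in\mathbb{R}\setminus\{0\}$ defines (realizes) the sign pattern $\sigma(Q)=(\mathrm{sgn}(a_d),\mathrm{sgn}(a_{d-1}),\ldots,\mathrm{sgn}(a_0))$. A real polynomial is hyperbolic if all its roots are real. Only hyperbolic polynomials with all coefficients non-vanishing (hence without root at $0$) and with all $d$ roots of pairwise distinct moduli are considered. Order of moduli: an order of moduli of length $d$ is a string of $d$ letters, each equal to $P$ or $N$, separated by signs $<$. A degree $d$ hyperbolic polynomial $Q$ with non-vanishing coefficients and roots of pairwise distinct moduli defines the order of moduli obtained by arranging the moduli of its roots in increasing order and writing $P$ for the modulus of a positive root and $N$ for the modulus of a negative root. A given order of moduli realizes a given sign pattern (equivalently, the sign pattern is realizable by this order of moduli) if there exists such a hyperbolic polynomial which defines both the given order of moduli and the given sign pattern. Canonical order of moduli: to a sign pattern of length $d+1$ one associates its canonical order of moduli as follows. The sign pattern is read from right to left (i.e. starting with the sign of the constant term), and to each couple of consecutive signs one puts in correspondence the letter $P$ if the two signs are opposite and the letter $N$ if they are identical; the letters, in the order in which they are obtained, are written from left to right separated by $<$. Thus for the sign pattern $(\sigma_d,\sigma_{d-1},\ldots,\sigma_0)$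 the $i$-th letter from the left ($1\le i\le d$) is $P$ if $\sigma_{i-1}\ne\sigma_i$ and $N$ if $\sigma_{i-1}=\sigma_i$. For example, to $(+,+,-,-,+,-,+,+,+,-)$ corresponds $P<N<N<P<P<P<N<P<N$. Canonical sign pattern: a sign pattern is called canonical if it is realizable only by its canonical order of moduli. (Each sign pattern is realizable by its canonical order of moduli.) *)

(* Defs.v *)
From HB Require Import structures.
From mathcomp Require Import all_boot all_order all_algebra.
From mathcomp Require Import complex reals.

Set Implicit Arguments.
Unset Strict Implicit.
Unset Printing Implicit Defensive.

Import Order.TTheory GRing.Theory Num.Theory.
Local Open Scope ring_scope.

Inductive sign := Plus | Minus.

Inductive letter := LetP | LetN.

Definition bool_of_sign (a : sign) : bool := if a is Plus then true else false.
Definition sign_of_bool (b : bool) : sign := if b then Plus else Minus.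
Lemma bool_of_signK : cancel bool_of_sign sign_of_bool. Proof. by case. Qed.
HB.instance Definition _ := Equality.copy sign (can_type bool_of_signK).

(* A sign pattern (sigma_d, ..., sigma_0) is the sequence
   [:: sigma_d; ...; sigma_0], leading sign first; an order of moduli
   L_1 < ... < L_d is the sequence [:: L_1; ...; L_d], smallest modulus first. *)

(* Only meaningful for nonzero arguments. *)
Definition sign_of (R : realType) (c : R) : sign :=
  if 0 < c then Plus else Minus.
Definition letter_of_root (R : realType) (x : R) : letter :=
  if 0 < x then LetP else LetN.

Definition hyperbolic (R : realType) (Q : {poly R}) : Prop :=
  forall z : R[i], root (map_poly (real_complex R) Q) z -> complex.Im z = 0.

(* The polynomial as a sequence lists its coefficients from the constant term
   up to the (nonzero) leading one, whence the reversal. *)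
Definition defines_sign_pattern (R : realType) (Q : {poly R}) (s : seq sign) :
    Prop :=
  (forall c : R, c \in (Q : seq R) -> c != 0) /\ rev (map (@sign_of R) Q) = s.

(* [rs] lists the roots of [Q] with multiplicity; strict sortedness says that
   their moduli are pairwise distinct and in increasing order. *)
Definition defines_order (R : realType) (Q : {poly R}) (o : seq letter) : Prop :=
  exists rs : seq R,
    [/\ Q = lead_coef Q *: \prod_(x <- rs) ('X - x%:P),
        sorted (fun x y : R => `|x| < `|y|) rs
      & map (@letter_of_root R) rs = o].

Definition realizes (R : realType) (o : seq letter) (s : seq sign) : Prop :=
  exists Q : {poly R},
    [/\ hyperbolic Q, defines_sign_pattern Q s & defines_order Q o].

Definition letter_of_signs (a b : sign) : letter :=
  if a == b then LetN else LetP.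

Definition canonical_order (s : seq sign) : seq letter :=
  if rev s is a :: t then pairmap letter_of_signs a t else [::].

Example canonical_order_example :
  canonical_order
    [:: Plus; Plus; Minus; Minus; Plus; Minus; Plus; Plus; Plus; Minus]
  = [:: LetP; LetN; LetN; LetP; LetP; LetP; LetN; LetP; LetN].
Proof. by []. Qed.

(* Realizable by the canonical order and by no other.  The first conjunct holds
   for every sign pattern. *)
Definition canonical (R : realType) (s : seq sign) : Prop :=
  realizes R (canonical_order s) s /\
  forall o : seq letter, realizes R o s -> o = canonical_order s.

Definition confA : seq sign := [:: Plus; Plus; Minus; Minus].
Definition confB : seq sign := [:: Minus; Minus; Plus; Plus].
Definition confC : seq sign := [:: Plus; Minus; Minus; Plus].
Definition confD : seq sign := [:: Minus; Plus; Plus; Minus].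

(* Main.v *)
Require Import Defs.
From mathcomp Require Import all_boot all_order all_algebra.
From mathcomp Require Import reals.
From mathcomp Require Import complex polyrcf ring lra zify.

(** The proof compares [Q] with [(X Q)' = Q + X Q'], whose [j]-th coefficient is
    [j + 1] times that of [Q], so that the sign pattern does not change.

    Iterating this operation multiplies the [j]-th coefficient by [(j + 1)^m].
    As [log (j + 1)] is strictly concave in [j], for [m] large each monomial
    dominates all others on a circle of its own; the signs at the real points of
    these circles then put exactly one root between consecutive circles, with
    the sign prescribed by the canonical order ([iter_euler_canonical]).

    It remains to see when the order of moduli changes on the way from [Q] to
    [(X Q)'].  By Rolle's theorem, every root of [Q] is replaced by one that is
    closer to [0] but farther than the preceding root of the same sign.  If the
    moduli of a positive and of a negative root are exchanged, or become equal,
    then the intermediate value theorem gives some [l > 0] for which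
    [Q + l X Q'] has two opposite roots [y] and [- y]
    ([opposite_roots_in_segment]).  This polynomial is still hyperbolic, by the
    argument of Gauss and Lucas, and has the same sign pattern.

    The heart of the matter is that a hyperbolic polynomial [(X^2 - b) P] with
    [b > 0] and no vanishing coefficient has four consecutive signs of the form
    [x, y, - x, - y] ([opposite_roots_window]), that is, one of the four
    configurations.  Its coefficients are [p_(j-2) - b p_j]: near the constant
    term they have the sign of [- p_j], near the leading one the sign of
    [p_(j-2)], and Newton's inequalities for [P] ensure that at the first place
    where the former rule fails the latter holds twice in a row.  Hence a
    pattern without configuration keeps its order of moduli during the whole
    iteration, so this order is the canonical one.

    Conversely, the four configurations are realized in degree 3 by a
    noncanonical order ([noncanonical_window]).  Multiplying by a linear factor
    whose root is very small or very large lengthens the sign pattern by any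
    given sign at either end, and adds the same letter to the order of moduli as
    to the canonical one ([realizes_cons], [realizes_rcons]); the order thus
    remains noncanonical.  The same lengthening, from degree 0, realizes the
    canonical order of any pattern. *)

Set Implicit Arguments.
Unset Strict Implicit.
Unset Printing Implicit Defensive.

Import Order.TTheory GRing.Theory Num.Theory.
Local Open Scope ring_scope.

(** * Hyperbolic polynomials: factorization, Gauss-Lucas, Newton *)

Section Hyperbolic.
Variable R : realType.
Implicit Types (P Q : {poly R}) (rs : seq R) (z : R[i]).

Local Notation toC := (map_poly (real_complex R)).

Lemma horner_toC_XsubC (x : R) z : (toC ('X - x%:P)).[z] = z - x%:C%C.
Proof. by rewrite rmorphB /= map_polyX map_polyC !hornerE. Qed.

Lemma hyperbolic_neq0 P : hyperbolic P -> P != 0.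
Proof.
move=> hP; apply/eqP=> P0; have := hP 'i%C.
rewrite P0 rmorph0 root0 => /(_ isT) /= /eqP.
by rewrite oner_eq0.
Qed.

Lemma hyperbolic_prod (c : R) rs :
  c != 0 -> hyperbolic (c *: \prod_(x <- rs) ('X - x%:P)).
Proof.
move=> c0 z; rewrite linearZ /= rootZ ?fmorph_eq0 //.
elim: rs => [|x rs IH]; first by rewrite big_nil rmorph1 (negbTE (root1 _)).
rewrite big_cons rmorphM rootM => /orP[|/IH //].
rewrite rootE horner_toC_XsubC subr_eq0 => /eqP ->.
by [].
Qed.

Lemma hyperbolic_split P : hyperbolic P ->
  exists rs, P = lead_coef P *: \prod_(x <- rs) ('X - x%:P).
Proof.
move=> hP; have P0 := hyperbolic_neq0 hP.
have [zs Ez] := closed_field_poly_normal (toC P).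
have lc0 : lead_coef (toC P) != 0.
  by rewrite lead_coef_eq0 map_poly_eq0.
exists [seq complex.Re z | z <- zs].
apply: (@map_poly_inj _ _ (real_complex R)).
rewrite linearZ /= [LHS]Ez lead_coef_map; congr (_ *: _).
have {Ez} : forall z, z \in zs -> complex.Im z = 0.
  by move=> z zin; apply: hP; rewrite Ez rootZ // root_prod_XsubC.
move=> zsR; rewrite map_prod_XsubC big_map; apply: eq_big_seq => z /zsR.
by case: z => a b /= ->.
Qed.

(** The logarithmic derivative of a polynomial with real roots maps the upper
    half plane into the closed lower one, being a sum of terms [1 / (z - x)]. *)
Lemma logarithmic_derivative (c : R) rs z : complex.Im z != 0 ->
  exists S : R[i],
    [/\ (toC (c *: \prod_(x <- rs) ('X - x%:P))^`()).[z] =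
          (toC (c *: \prod_(x <- rs) ('X - x%:P))).[z] * S,
        complex.Im z * complex.Im S <= 0
      & rs != [::] -> complex.Im z * complex.Im S < 0].
Proof.
move=> Iz.
suff [S [ES S0 S1]] : exists S : R[i],
    [/\ (toC (\prod_(x <- rs) ('X - x%:P))^`()).[z] =
          (toC (\prod_(x <- rs) ('X - x%:P))).[z] * S,
        complex.Im z * complex.Im S <= 0
      & rs != [::] -> complex.Im z * complex.Im S < 0].
  exists S; split=> //.
  by rewrite derivZ !linearZ /= !hornerZ ES mulrA.
elim: rs => [|x rs [S [ES S0 S1]]].
  exists 0; split=> //=; last by rewrite mulr0.
  by rewrite big_nil derivC rmorph0 horner0 mulr0.
have zx : z - x%:C%C != 0.
  apply/eqP=> /(congr1 (@complex.Im _)); case: z Iz {ES S0 S1} => a b /= b0.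
  by rewrite oppr0 addr0 => /eqP; rewrite (negbTE b0).
have neg : complex.Im z * complex.Im (z - x%:C%C)^-1 < 0.
  case: z Iz {ES S0 S1 zx} => a b /= b0; rewrite oppr0 addr0.
  have den : 0 < (a - x) ^+ 2 + b ^+ 2.
    by rewrite ltr_wpDl ?sqr_ge0 // lt_def sqr_ge0 sqrf_eq0 b0.
  rewrite mulrN oppr_lt0 mulrA -expr2 divr_gt0 //.
  by rewrite lt_def sqr_ge0 sqrf_eq0 b0.
have ImD (u v : R[i]) : complex.Im (u + v) = complex.Im u + complex.Im v.
  by case: u v => [a b] [a' b'].
exists ((z - x%:C%C)^-1 + S); split.
- rewrite big_cons derivM derivXsubC mul1r rmorphD !rmorphM hornerD !hornerM.
  by rewrite /= ES horner_toC_XsubC; field.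
- by rewrite ImD mulrDr; lra.
- by rewrite ImD mulrDr; lra.
Qed.

(** Gauss-Lucas: outside the real line, the logarithmic derivative of [P] has a
    nonzero imaginary part. *)
Lemma hyperbolic_deriv P : hyperbolic P -> (1 < size P)%N -> hyperbolic P^`().
Proof.
move=> hP sP z rz; apply/eqP; case: eqP => // /eqP Iz.
have [rs EP] := hyperbolic_split hP.
have Pz : (toC P).[z] != 0 by apply/negP=> /hP/eqP; rewrite (negbTE Iz).
have [S []] := logarithmic_derivative (lead_coef P) rs Iz.
rewrite -EP (eqP rz) => /esym/eqP; rewrite mulf_eq0 (negbTE Pz) => /= /eqP ->.
case: (eqVneq rs [::]) => [rs0 _ _|_ _ /(_ isT)]; last by rewrite mulr0 ltxx.
move: sP; rewrite EP rs0 big_nil.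
by rewrite alg_polyC ltnNge size_polyC_leq1.
Qed.

(** Adding a positive multiple of [X P'] amounts to differentiating
    [X^(1/l) P], so that Gauss-Lucas applies once more. *)
Lemma hyperbolic_addXderiv P (l : R) :
  0 < l -> hyperbolic P -> hyperbolic (P + l *: ('X * P^`())).
Proof.
move=> l0 hP z rz; apply/eqP; case: eqP => // /eqP Iz.
have [rs EP] := hyperbolic_split hP.
have Pz : (toC P).[z] != 0 by apply/negP=> /hP/eqP; rewrite (negbTE Iz).
have [S []] := logarithmic_derivative (lead_coef P) rs Iz.
rewrite -EP => ES S0 _.
move: rz; rewrite rootE rmorphD /= linearZ /= rmorphM /= map_polyX.
rewrite hornerD hornerZ hornerM hornerX ES.
have -> : (toC P).[z] + l%:C%C * (z * ((toC P).[z] * S)) =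
          (toC P).[z] * (1 + l%:C%C * (z * S)) by ring.
rewrite mulf_eq0 (negbTE Pz) /=.
case: z S Iz S0 {ES Pz} => a b [u v] /= b0 bv.
rewrite eq_complex /= => /andP[/eqP E1 /eqP E2].
have b2 : 0 < b ^+ 2 by rewrite lt_def sqr_ge0 sqrf_eq0 b0.
(* The imaginary part of [conj z * (1 + l z S)]. *)
have : a * (l * (a * v + b * u)) - b * (l * (a * u - b * v)) - b = 0.
  have -> : l * (a * u - b * v) = -1 by move: E1; rewrite mul0r subr0; lra.
  have -> : l * (a * v + b * u) = 0 by move: E2; rewrite mul0r; lra.
  by ring.
have -> : a * (l * (a * v + b * u)) - b * (l * (a * u - b * v)) - b
  = l * (a ^+ 2 + b ^+ 2) * v - b by ring.
move/(congr1 (fun t => b * t)); rewrite mulr0 mulrBr -expr2.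
have : l * (a ^+ 2 + b ^+ 2) * (b * v) <= 0.
  rewrite mulr_ge0_le0 // mulr_ge0 ?(ltW l0) //.
  by rewrite addr_ge0 ?sqr_ge0.
lra.
Qed.

(** The difference of the two sides is the sum, over the roots [x] of [P], of
    the squares of the values at [0] of [P / (X - x)]. *)
Lemma laguerre_at0 P : hyperbolic P -> 2 * (P`_0 * P`_2) <= P`_1 ^+ 2.
Proof.
move=> /hyperbolic_split[rs ->]; set c := lead_coef P; rewrite !coefZ.
rewrite -subr_ge0.
set p := \prod_(_ <- _) _.
have -> : (c * p`_1) ^+ 2 - 2 * (c * p`_0 * (c * p`_2)) =
  c ^+ 2 * (p`_1 ^+ 2 - 2 * (p`_0 * p`_2)) by ring.
rewrite mulr_ge0 ?sqr_ge0 // {}/p {c}.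
elim: rs => [|x rs]; first by rewrite big_nil !coef1 /=; lra.
rewrite big_cons; set p := \prod_(_ <- rs) _ => IH.
rewrite !mulrBl !coefB !coefXM !coefCM /=.
have -> : (p`_0 - x * p`_1) ^+ 2 - 2 * ((0 - x * p`_0) * (p`_1 - x * p`_2)) =
  p`_0 ^+ 2 + x ^+ 2 * (p`_1 ^+ 2 - 2 * (p`_0 * p`_2)) by ring.
by rewrite addr_ge0 ?sqr_ge0 // mulr_ge0 ?sqr_ge0.
Qed.

(** Newton's inequalities: differentiation shifts the coefficients, and turns the
    inequality at [n] for [P'] into the one at [n + 1] for [P]. *)
Lemma newton P n : hyperbolic P ->
  n.+2%:R * (P`_n * P`_n.+2) <= n.+1%:R * P`_n.+1 ^+ 2.
Proof.
elim: n P => [|n IH] P hP; first by rewrite mul1r laguerre_at0.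
have [sP|sP] := leqP (size P) 1.
  by rewrite !(nth_default _ (leq_trans sP _)) // !(mul0r, mulr0) expr0n mulr0.
have := IH _ (hyperbolic_deriv hP sP); rewrite !coef_deriv.
rewrite -(mulr_natl P`_n.+1) -(mulr_natl P`_n.+2) -(mulr_natl P`_n.+3).
set a := P`_n.+1; set b := P`_n.+2; set c := P`_n.+3 => H.
have p1 : 0 < n.+1%:R * n.+2%:R :> R by rewrite mulr_gt0 ?ltr0Sn.
rewrite -(ler_pM2l p1).
have -> : n.+1%:R * n.+2%:R * (n.+3%:R * (a * c)) =
  n.+2%:R * (n.+1%:R * a * (n.+3%:R * c)) :> R by ring.
by apply: le_trans H _; rewrite le_eqVlt; apply/orP; left; apply/eqP; ring.
Qed.

End Hyperbolic.

(** * A pair of opposite roots forces a configuration *)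

Definition has_configuration (s : seq sign) : bool :=
  [|| infix confA s, infix confB s, infix confC s | infix confD s].

Lemma window_configuration (t : seq sign) k :
    (k.+3 < size t)%N -> nth Plus t k != nth Plus t k.+2 ->
    nth Plus t k.+1 != nth Plus t k.+3 ->
  has_configuration (rev t).
Proof.
move=> kt n02 n13.
have : infix [:: nth Plus t k; nth Plus t k.+1; nth Plus t k.+2; nth Plus t k.+3] t.
  apply/infixP; exists (take k t), (drop k.+4 t).
  rewrite -{1}[t](cat_take_drop k) (drop_nth Plus) ?(drop_nth Plus (n := k.+1)) //;
    do ?lia.
  by rewrite (drop_nth Plus (n := k.+2)) ?(drop_nth Plus (n := k.+3)) //; lia.
rewrite -infix_rev /rev /=.
by move: n02 n13; case: (nth _ t k); case: (nth _ t k.+1);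
  case: (nth _ t k.+2); case: (nth _ t k.+3) => // _ _; rewrite /has_configuration
  /confA /confB /confC /confD => ->; rewrite ?orbT.
Qed.

Section Config.
Variable R : realType.
Implicit Types (P Q S : {poly R}) (s : seq sign).

(** Write [p_j] for the coefficients of [P]; those of [S] are
    [s_j = p_(j-2) - b p_j].  Let [k] be the first index where [s_k] does not
    have the sign of [- p_k].  Then [s_(k-2)] and [s_(k-1)] have the signs of
    [- p_(k-2)] and [- p_(k-1)], while [s_k] has the sign of [p_(k-2)], and
    Newton's inequalities at [k - 1] and [k] leave only the sign of [p_(k-1)]
    for [s_(k+1)]. *)
Lemma opposite_roots_window P S (b : R) :
    hyperbolic P -> 0 < b -> S = ('X^2 - b%:P) * P ->
    (forall j, (j < size S)%N -> S`_j != 0) ->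
  exists k, [/\ (k.+3 < size S)%N, S`_k * S`_k.+2 < 0
              & S`_k.+1 * S`_k.+3 < 0].
Proof.
move=> hP b0 ES S0; have P0 := hyperbolic_neq0 hP.
have sS : size S = (size P).+2.
  by rewrite ES size_monicM ?monicXnsubC // size_XnsubC.
have ES01 j : (j < 2)%N -> S`_j = - (b * P`_j).
  by move=> j2; rewrite ES mulrBl coefB coefXnM j2 coefCM sub0r.
have ES2 j : S`_j.+2 = P`_j - b * P`_j.+2.
  by rewrite ES mulrBl coefB coefXnM /= coefCM subn2.
have ex : exists k, 0 <= S`_k * P`_k.
  by exists (size P); rewrite [P`_(size P)]nth_default // mulr0.
have [k kge kmin] := ex_minnP ex.
have sP : (0 < size P)%N by rewrite size_poly_gt0.
have k_le : (k <= size P)%N.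
  by apply: kmin; rewrite [P`_(size P)]nth_default // mulr0.
have below j : (j < k)%N -> S`_j * P`_j < 0.
  by move=> jk; rewrite ltNge; apply: contraTN jk => /kmin; rewrite -leqNgt.
have k2 : (2 <= k)%N.
  rewrite leqNgt; apply/negP => lt_k2.
  have := S0 k; rewrite sS ltnS (leq_trans k_le) // => /(_ isT).
  move: kge; rewrite ES01 //; have [->|Pk0] := eqVneq P`_k 0.
    by rewrite !mulr0 oppr0 eqxx.
  rewrite mulNr oppr_ge0 -mulrA => H _; have : 0 < b * (P`_k * P`_k).
    by rewrite mulr_gt0 // -expr2 lt_def sqr_ge0 sqrf_eq0 Pk0.
  by rewrite ltNge H.
case: k k2 kge kmin k_le below => [|[|m]] // _ kge _ k_le below.
have Sm := below m (leqnSn _); have Sm1 := below m.+1 (leqnn _).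
have Sm2 : 0 < S`_m.+2 * P`_m.
  have s0 : 0 < S`_m.+2 ^+ 2.
    by rewrite lt_def sqr_ge0 sqrf_eq0 S0 // sS; lia.
  have -> : S`_m.+2 * P`_m = S`_m.+2 ^+ 2 + b * (S`_m.+2 * P`_m.+2).
    by rewrite ES2; ring.
  by rewrite ltr_pwDl // mulr_ge0 // ltW.
(* Otherwise [b p_m.+1 p_m.+3 >= p_m.+1 ^ 2], besides
   [p_m p_m.+2 >= b p_m.+2 ^ 2]; the two Newton inequalities then chain into
   [(m + 3) p_m.+1 ^ 2 <= (m + 1) p_m.+1 ^ 2]. *)
have Sm3 : 0 < S`_m.+3 * P`_m.+1.
  rewrite ltNge; apply/negP => H.
  have p1 : 0 < P`_m.+1 ^+ 2.
    rewrite lt_def sqr_ge0 sqrf_eq0 andbT.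
    by apply: contraTneq Sm1 => ->; rewrite mulr0 ltxx.
  move: H kge; rewrite !ES2 !mulrBl -!mulrA -!expr2 subr_le0 subr_ge0 => H1 H2.
  have N1 := newton m hP; have N2 := newton m.+1 hP.
  have nat0 n : 0 < n.+1%:R :> R by rewrite ltr0Sn.
  have C1 : m.+2%:R * (b * P`_m.+2 ^+ 2) <= m.+1%:R * P`_m.+1 ^+ 2.
    by apply: le_trans N1; rewrite ler_pM2l.
  have C2 : m.+3%:R * P`_m.+1 ^+ 2 <= b * (m.+2%:R * P`_m.+2 ^+ 2).
    apply: le_trans (_ : m.+3%:R * (b * (P`_m.+1 * P`_m.+3)) <= _).
      by rewrite ler_pM2l // [P`_m.+1 * _]mulrC.
    by rewrite mulrCA ler_pM2l.
  have C3 : m.+3%:R * P`_m.+1 ^+ 2 <= m.+1%:R * P`_m.+1 ^+ 2.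
    by apply: le_trans C1; rewrite [_ * (b * _)]mulrCA.
  by move: C3; rewrite ler_pM2r // ler_nat ltnNge ltnW.
have opp (x y p : R) : x * p < 0 -> 0 < y * p -> x * y < 0.
  move=> xp yp; have : (x * p) * (y * p) < 0 by rewrite nmulr_rlt0.
  have -> : x * p * (y * p) = (x * y) * p ^+ 2 by ring.
  by apply: contraTT; rewrite -!leNgt => xy; rewrite mulr_ge0 ?sqr_ge0.
exists m; split; [by rewrite sS; lia| exact: opp Sm Sm2 | exact: opp Sm1 Sm3].
Qed.

End Config.

(** * Sign patterns and orders of moduli through indices *)

Definition signr (R : realType) (a : sign) : R := if a is Plus then 1 else -1.
Arguments signr R a : clear implicits.

(** Contrary to a sign pattern, [t] starts with the sign of the constant term,
    so that positions in [t] are exponents. *)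
Definition has_signs (R : realType) (Q : {poly R}) (t : seq sign) : Prop :=
  size Q = size t /\
  forall j, (j < size t)%N -> 0 < signr R (nth Plus t j) * Q`_j.

Section Signs.
Variable R : realType.
Implicit Types (P Q : {poly R}) (s t : seq sign) (o : seq letter).

Lemma sign_ofP (a : sign) (c : R) : c != 0 ->
  (sign_of c = a) <-> 0 < signr R a * c.
Proof.
rewrite /sign_of; case: a; case: ltrgt0P => // c0 _;
  by rewrite ?mul1r ?mulN1r ?oppr_gt0 ?c0 ?(lt_gtF c0).
Qed.

Lemma defines_sign_patternP Q s :
  defines_sign_pattern Q s <-> has_signs Q (rev s).
Proof.
split=> [[Q0 <-]|[sQ sg]].
  rewrite revK; split; first by rewrite size_map.
  move=> j; rewrite size_map => jQ; rewrite (nth_map 0) //.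
  by apply/sign_ofP => //; apply: Q0; rewrite mem_nth.
have Q0 j : (j < size Q)%N -> Q`_j != 0.
  by rewrite sQ => /sg; apply: contraTneq => ->; rewrite mulr0 ltxx.
split; first by move=> c /(nthP 0)[j jQ <-]; apply: Q0.
apply: (can_inj revK); rewrite revK.
apply: (@eq_from_nth _ Plus); first by rewrite size_map.
move=> j; rewrite size_map => jQ; rewrite (nth_map 0) //.
by apply/sign_ofP; [exact: Q0 | apply: sg; rewrite -sQ].
Qed.

Lemma has_signs_neq0 Q t j : has_signs Q t -> (j < size Q)%N -> Q`_j != 0.
Proof.
by case=> -> sg /sg; apply: contraTneq => ->; rewrite mulr0 ltxx.
Qed.

Lemma has_signs_neq Q t i j : has_signs Q t -> (i < size Q)%N ->
  (j < size Q)%N -> (nth Plus t i != nth Plus t j) = (Q`_i * Q`_j < 0).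
Proof.
move=> [-> sg] /sg + /sg.
case: (nth _ _ i); case: (nth _ _ j) => /= i0 j0; rewrite ?eqxx /=.
- by apply/esym/negbTE; rewrite -leNgt mulr_ge0; lra.
- by apply/esym; rewrite pmulr_rlt0; lra.
- by apply/esym; rewrite nmulr_rlt0; lra.
- by apply/esym/negbTE; rewrite -leNgt mulr_le0; lra.
Qed.

Lemma lead_coefZ_prod (c : R) (I : Type) (rs : seq I) (f : I -> R) :
  lead_coef (c *: \prod_(i <- rs) ('X - (f i)%:P)) = c.
Proof.
by rewrite lead_coefZ (monicP (monic_prod_XsubC _ _ _)) mulr1.
Qed.

Lemma split_of_roots Q n (y : 'I_n -> R) : size Q = n.+1 ->
  (forall i, root Q (y i)) -> injective y ->
  Q = lead_coef Q *: \prod_i ('X - (y i)%:P).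
Proof.
move=> sQ ry inj; rewrite -big_enum -(big_map y xpredT (fun a => 'X - a%:P)) /=.
apply: all_roots_prod_XsubC.
- by rewrite sQ size_map -cardE card_ord.
- by apply/allP => _ /mapP[i _ ->].
- by rewrite uniq_rootsE map_inj_uniq ?enum_uniq.
Qed.

Lemma defines_orderP Q o : defines_order Q o <->
  exists r : 'I_(size o) -> R,
    [/\ Q = lead_coef Q *: \prod_i ('X - (r i)%:P),
        forall i j : 'I_(size o), (i < j)%N -> `|r i| < `|r j|
      & forall i, letter_of_root (r i) = nth LetP o i].
Proof.
split=> [[rs [EQ srt <-]]|[r [EQ inc lett]]].
  rewrite size_map; exists (fun i => rs`_i); split=> [|i j ij|i].
  - by rewrite {1}EQ (big_nth 0) big_mkord.
  - by apply: (@sorted_ltn_nth _ (fun x y : R => `|x| < `|y|)) => //;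
      [move=> ? ? ? /=; apply: lt_trans | rewrite inE ltn_ord..].
  - by rewrite (nth_map 0).
exists [seq r i | i <- enum 'I_(size o)]; split.
- by rewrite {1}EQ big_map big_enum.
- rewrite sorted_map.
  apply: (@sub_sorted _ (relpre val ltn)) => [i j|]; first exact: inc.
  by rewrite -sorted_map val_enum_ord iota_ltn_sorted.
- have sz : size [seq r i | i <- enum 'I_(size o)] = size o.
    by rewrite size_map -cardE card_ord.
  apply: (@eq_from_nth _ LetP) => [|i]; first by rewrite size_map sz.
  rewrite size_map sz => io; rewrite (nth_map 0) ?sz //.
  rewrite (nth_map (Ordinal io)) -?cardE ?card_ord //.
  by rewrite (nth_ord_enum (Ordinal io) (Ordinal io)) lett.
Qed.

(** A polynomial determines the set of its roots, hence their only list sorted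
    by strictly increasing moduli. *)
Lemma defines_order_uniq Q o o' : Q != 0 ->
  defines_order Q o -> defines_order Q o' -> o = o'.
Proof.
move=> Q0 [rs [EQ srt <-]] [rs' [EQ' srt' <-]]; congr map.
apply: irr_sorted_eq srt srt' _ => [y x z /=|x|x].
- exact: lt_trans.
- exact: ltxx.
- by rewrite -!root_prod_XsubC -(rootZ _ _ (a := lead_coef Q)) ?lead_coef_eq0 //
    -EQ EQ' rootZ ?lead_coef_eq0.
Qed.

Lemma defines_order_hyperbolic Q o : Q != 0 -> defines_order Q o -> hyperbolic Q.
Proof.
move=> Q0 [rs [-> _ _]]; apply: hyperbolic_prod.
by rewrite lead_coef_eq0.
Qed.

End Signs.

(** * Invariance of the order of moduli under [Q + X Q'] *)

(** The Euler operator [X d/dX], scaled and added to the identity: for [l] from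
    [0] to [1], a segment that leads from [Q] to [(X Q)']. *)
Definition euler (R : realType) (l : R) (Q : {poly R}) : {poly R} :=
  Q + l *: ('X * Q^`()).

Section Euler.
Variable R : realType.
Implicit Types (P Q : {poly R}) (s t : seq sign) (o : seq letter).

Lemma coef_euler l Q j : (euler l Q)`_j = (1 + l * j%:R) * Q`_j.
Proof.
rewrite /euler coefD coefZ coefXM; case: j => [|j] /=; first by rewrite !mulr0; ring.
by rewrite coef_deriv -(mulr_natl Q`_j.+1) ; ring.
Qed.

Lemma euler1E Q : euler 1 Q = ('X * Q)^`().
Proof. by rewrite /euler scale1r derivM derivX mul1r. Qed.

Lemma horner_euler l Q x :
  (euler l Q).[x] = (1 - l) * Q.[x] + l * (euler 1 Q).[x].
Proof. by rewrite /euler scale1r !hornerD hornerZ; ring. Qed.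

Lemma euler_signs l Q t : 0 <= l -> has_signs Q t -> has_signs (euler l Q) t.
Proof.
move=> l0 QS; have pos j : 0 < 1 + l * j%:R :> R.
  by rewrite ltr_wpDr // mulr_ge0.
split=> [|j jt]; last by rewrite coef_euler mulrCA mulr_gt0 //; apply: QS.2.
have sz : (size (euler l Q) <= size Q)%N.
  by apply/leq_sizeP => j Qj; rewrite coef_euler nth_default ?mulr0.
rewrite -QS.1; apply/eqP; rewrite eqn_leq sz /=.
case E : (size Q) => [//|n]; rewrite ltnNge; apply/negP => /leq_sizeP/(_ n).
rewrite leqnn coef_euler => /(_ isT)/eqP; rewrite mulf_eq0 gt_eqF //=.
by apply/negP; apply: has_signs_neq0 QS _; rewrite E.
Qed.

Lemma opposite_roots_configuration Q t y : hyperbolic Q -> has_signs Q t ->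
  y != 0 -> root Q y -> root Q (- y) -> has_configuration (rev t).
Proof.
move=> hQ QS y0 ry rNy.
have [P EQ] : exists P, Q = P * \prod_(z <- [:: y; - y]) ('X - z%:P).
  apply: uniq_roots_prod_XsubC; first by rewrite /= ry rNy.
  by rewrite uniq_rootsE /= inE andbT -addr_eq0 -mulr2n mulrn_eq0.
have {}EQ : Q = ('X^2 - (y ^+ 2)%:P) * P.
  by rewrite EQ !big_cons big_nil rmorphN rmorphXn /=; ring.
have hP : hyperbolic P.
  by move=> z rz; apply: hQ; rewrite EQ rmorphM rootM rz orbT.
have y2 : 0 < y ^+ 2 by rewrite lt_def sqr_ge0 sqrf_eq0 y0.
have [k [ks neg0 neg1]] :=
  opposite_roots_window hP y2 EQ (fun j => has_signs_neq0 QS).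
by apply: (@window_configuration t k); rewrite -?QS.1 // (has_signs_neq QS) //; lia.
Qed.

(** Intermediate value and Rolle theorems on an interval between two points of
    the same sign, in terms of moduli. *)
Lemma ivt_same_side P a b : 0 < a * b -> `|a| < `|b| -> P.[a] * P.[b] < 0 ->
  exists w, [/\ root P w, 0 < w * b, `|a| < `|w| & `|w| < `|b|].
Proof.
move=> ab; case: (ltrgt0P b) => [b0|b0|b0]; last by move: ab; rewrite b0 mulr0 ltxx.
- have a0 : 0 < a by rewrite -(pmulr_lgt0 _ b0).
  rewrite gtr0_norm // => lt_ab /(poly_ivtoo (ltW lt_ab))[w].
  rewrite in_itv /= => /andP[aw wb] rw; have w0 := lt_trans a0 aw.
  by exists w; rewrite gtr0_norm // mulr_gt0.
- have a0 : a < 0 by rewrite -(nmulr_lgt0 _ b0).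
  rewrite ltr0_norm // ltrN2 mulrC => lt_ab /(poly_ivtoo (ltW lt_ab))[w].
  rewrite in_itv /= => /andP[aw wb] rw; have w0 := lt_trans wb a0.
  by exists w; rewrite ltr0_norm // !ltrN2 nmulr_rgt0.
Qed.

Lemma rolle_same_side P a b : 0 <= a * b -> `|a| < `|b| -> root P a -> root P b ->
  exists w, [/\ root P^`() w, 0 < w * b, `|a| < `|w| & `|w| < `|b|].
Proof.
move=> ab; case: (ltrgt0P b) => [b0|b0|->]; last by rewrite normr_lt0.
- have a0 : 0 <= a by rewrite -(pmulr_lge0 _ b0).
  rewrite ger0_norm // => lt_ab /eqP Pa /eqP Pb.
  have [w] := poly_rolle lt_ab (etrans Pa (esym Pb)).
  rewrite in_itv /= => /andP[aw wb] /eqP rw; have w0 := le_lt_trans a0 aw.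
  by exists w; rewrite gtr0_norm // mulr_gt0.
- have a0 : a <= 0 by rewrite -(nmulr_lge0 _ b0).
  rewrite ler0_norm // ltrN2 => lt_ab /eqP Pa /eqP Pb.
  have [w] := poly_rolle lt_ab (etrans Pb (esym Pa)).
  rewrite in_itv /= => /andP[aw wb] /eqP rw; have w0 := lt_le_trans wb a0.
  by exists w; rewrite ltr0_norm // !ltrN2 nmulr_rgt0.
Qed.

Lemma mulr_gt0_trans (a b c : R) : 0 < a * b -> 0 < b * c -> 0 < a * c.
Proof.
move=> ab bc; have : 0 < (a * b) * (b * c) by rewrite mulr_gt0.
rewrite (_ : _ * _ = b ^+ 2 * (a * c)); last by ring.
by apply: contraTT; rewrite -!leNgt; apply: mulr_ge0_le0; rewrite sqr_ge0.
Qed.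

(** In the applications [c] runs over the roots that do not separate [a]
    from [b]. *)
Lemma same_side_factor_gt0 (a b c : R) : 0 < a * b ->
    [\/ c * b < 0, `|c| < `|a| /\ `|c| < `|b| | `|a| < `|c| /\ `|b| < `|c|] ->
  0 < (a - c) * (b - c).
Proof.
move=> ab H; wlog b0 : a b c ab H / 0 < b.
  move=> WL; case: (ltrgt0P b) => [|b0|b0].
  - exact: WL.
  - have -> : (a - c) * (b - c) = (- a - - c) * (- b - - c) by ring.
    by apply: WL; rewrite ?mulrNN ?normrN ?oppr_gt0.
  - by move: ab; rewrite b0 mulr0 ltxx.
have a0 : 0 < a by rewrite -(pmulr_lgt0 _ b0).
move: H; rewrite (gtr0_norm a0) (gtr0_norm b0) pmulr_llt0 // => H.
case: (ltrP c 0) => [c0|c0]; first by rewrite mulr_gt0 //; lra.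
move: H; rewrite ger0_norm // => -[|[ca cb]|[ac bc]]; first by rewrite ltNge c0.
- by rewrite mulr_gt0 // subr_gt0.
- by rewrite nmulr_rgt0 subr_lt0.
Qed.

End Euler.

Section EulerRoots.
Variables (R : realType) (n : nat) (Q : {poly R}) (r : 'I_n -> R).
Hypothesis EQ : Q = lead_coef Q *: \prod_i ('X - (r i)%:P).
Hypothesis inc : forall i j : 'I_n, (i < j)%N -> `|r i| < `|r j|.
Hypothesis Q0 : Q`_0 != 0.

Local Notation G := (euler 1 Q).

Lemma ordered_root i : root Q (r i).
Proof.
by rewrite EQ rootE (bigD1 i) //= hornerZ hornerM hornerXsubC subrr mul0r mulr0.
Qed.

Lemma ordered_root_neq0 i : r i != 0.
Proof.
apply: contraNneq Q0 => r0; have := ordered_root i.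
by rewrite r0 rootE horner_coef0.
Qed.

(** Rolle's theorem for [X Q] between [r i] and the preceding root on the same
    side of [0], or [0] when there is none. *)
Lemma euler_root_below i : exists y,
  [/\ root G y, 0 < y * r i, `|y| < `|r i|
    & forall k : 'I_n, (k < i)%N -> 0 < r k * r i -> `|r k| < `|y|].
Proof.
suff [p [rp pi p_lt p_max]] : exists p, [/\ root ('X * Q) p, 0 <= p * r i,
    `|p| < `|r i|
    & forall k : 'I_n, (k < i)%N -> 0 < r k * r i -> `|r k| <= `|p|].
  have [|w [rw wi pw wr]] := rolle_same_side pi p_lt rp (b := r i).
    by rewrite rootM ordered_root orbT.
  exists w; split; rewrite ?euler1E // => k ki rki.
  exact: le_lt_trans (p_max k ki rki) pw.
suff : forall m, (m <= i)%N -> exists p, [/\ root ('X * Q) p, 0 <= p * r i,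
    `|p| < `|r i|
    & forall k : 'I_n, (k < m)%N -> 0 < r k * r i -> `|r k| <= `|p|].
  by apply.
elim=> [|m IH] mi.
  exists 0; split=> //; first by rewrite rootM rootX eqxx.
    by rewrite mul0r.
  by rewrite normr0 normr_gt0 ordered_root_neq0.
have [p [rp pi p_lt p_max]] := IH (ltnW mi).
pose m' := Ordinal (ltn_trans mi (ltn_ord i)).
case: (ltrP 0 (r m' * r i)) => [mi0|mi0].
  exists (r m'); split; [by rewrite rootM ordered_root orbT|exact: ltW|exact: inc|].
  move=> k; rewrite ltnS leq_eqVlt => /orP[/eqP km _|km _]; last exact/ltW/inc.
  by rewrite (_ : k = m') //; apply: val_inj.
exists p; split=> // k; rewrite ltnS leq_eqVlt => /orP[/eqP km|km]; last exact: p_max.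
by rewrite (_ : k = m') ?ltNge ?mi0 //; apply: val_inj.
Qed.

(** [y i] is the root of [G] that replaces [r i]. *)
Variable y : 'I_n -> R.
Hypothesis yP : forall i,
  [/\ root G (y i), 0 < y i * r i, `|y i| < `|r i|
    & forall k : 'I_n, (k < i)%N -> 0 < r k * r i -> `|r k| < `|y i|].

Lemma euler_root_lt (i j : 'I_n) : (i < j)%N -> 0 < r i * r j -> `|y i| < `|y j|.
Proof.
by move=> ij ri; have [_ _ lt_i _] := yP i; have [_ _ _ /(_ i ij ri)] := yP j;
  apply: lt_trans.
Qed.

Lemma letter_of_euler_root i : letter_of_root (y i) = letter_of_root (r i).
Proof.
rewrite /letter_of_root; have [_ yr _ _] := yP i; congr (if _ then _ else _).
case: (ltrgt0P (r i)) yr => [r0|r0|->]; last by rewrite mulr0 ltxx.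
  by rewrite pmulr_lgt0.
by rewrite nmulr_lgt0 // => /lt_gtF.
Qed.

Lemma euler_root_inj : injective y.
Proof.
move=> i j Eij; apply/eqP; case: eqP => // /eqP; rewrite neq_ltn => ne.
wlog ij : i j Eij {ne} / (i < j)%N.
  by move=> WL; case/orP: ne => [/WL|/WL]; apply.
have [_ yri _ _] := yP i; have [_ yrj _ _] := yP j.
have /(euler_root_lt ij) : 0 < r i * r j.
  by apply: mulr_gt0_trans yrj; rewrite mulrC Eij in yri *.
by rewrite Eij ltxx.
Qed.

Hypothesis size_G : size G = size Q.

Lemma euler_split : G = lead_coef G *: \prod_i ('X - (y i)%:P).
Proof.
have cQ : lead_coef Q != 0.
  by rewrite lead_coef_eq0; apply: contraNneq Q0 => ->; rewrite coef0.
apply: split_of_roots => [|i|]; [|by have [] := yP i|exact: euler_root_inj].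
by rewrite size_G EQ size_scale // size_prod_XsubC /index_enum -enumT -cardE card_ord.
Qed.

(** Both values are compared with [G.[r j]].  No root of [Q] other than [r j] and
    no root of [G] other than [y j] has a modulus between those of [y j] and
    [r j] on their side of [0], so [G.[v]] has the sign of [G.[r j]].  If
    [Q = (X - r j) Q_j], then [G.[r j] = r j * Q_j.[r j]], whereas
    [Q.[u] = (u - r j) * Q_j.[u]] with [u - r j] of the sign of [- r j]. *)
Lemma opposite_signs_between j u v : 0 < u * r j -> 0 < v * r j ->
    `|y j| <= `|u| -> `|u| < `|r j| -> `|y j| < `|v| -> `|v| <= `|r j| ->
  Q.[u] * G.[v] < 0.
Proof.
move=> uj vj yu ur yv vr.
have [_ yrj ltj below_j] := yP j.
have [c cQ] : {c | c = lead_coef Q} by exists (lead_coef Q).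
have c0 : c != 0.
  by rewrite cQ lead_coef_eq0; apply: contraNneq Q0 => ->; rewrite coef0.
pose Qj : {poly R} := c *: \prod_(i | i != j) ('X - (r i)%:P).
have EQj : Q = ('X - (r j)%:P) * Qj by rewrite EQ -cQ (bigD1 j) //= /Qj scalerAr.
have rjj : 0 < r j * r j by rewrite -expr2 lt_def sqr_ge0 sqrf_eq0 ordered_root_neq0.
have sgn_r k : k != j -> r k * r j <= 0 -> r k * r j < 0.
  by rewrite lt_neqAle mulf_eq0 !negb_or !ordered_root_neq0 => _ ->.
have Qj_same : 0 < Qj.[u] * Qj.[r j].
  rewrite /Qj !hornerZ !horner_prod mulrACA -expr2.
  rewrite pmulr_rgt0; last by rewrite lt_def sqr_ge0 sqrf_eq0 c0.
  rewrite -big_split /=; apply: prodr_gt0 => k kj; rewrite !hornerXsubC.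
  apply: same_side_factor_gt0 => //.
  case: (ltrP 0 (r k * r j)) => [rkj|/(sgn_r _ kj)]; last by constructor 1.
  move: kj; rewrite -val_eqE neq_ltn => /orP[kj|jk].
    constructor 2; split; last exact: inc.
    exact: lt_le_trans (below_j k kj rkj) yu.
  by constructor 3; split; [exact: lt_trans ur (inc jk)|exact: inc].
have G_rj : G.[r j] = r j * Qj.[r j].
  rewrite euler1E derivM derivX mul1r EQj derivM derivXsubC.
  by rewrite !(hornerD, hornerM, hornerX, hornerN, hornerC); ring.
have QG : Q.[u] * G.[r j] < 0.
  rewrite G_rj EQj hornerM hornerXsubC.
  rewrite mulrACA.
  rewrite pmulr_llt0 // mulrBl subr_lt0.
  rewrite -(ger0_norm (ltW uj)) -(ger0_norm (ltW rjj)) !normrM ltr_pM2r //.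
  by rewrite normr_gt0 ordered_root_neq0.
have Gc0 : lead_coef G != 0.
  by rewrite lead_coef_eq0 -size_poly_gt0 size_G size_poly_gt0 -lead_coef_eq0 -cQ.
have G_same : 0 < G.[v] * G.[r j].
  rewrite euler_split !hornerZ !horner_prod mulrACA -expr2.
  rewrite pmulr_rgt0; last by rewrite lt_def sqr_ge0 sqrf_eq0 Gc0.
  rewrite -big_split /=; apply: prodr_gt0 => k _; rewrite !hornerXsubC.
  apply: same_side_factor_gt0 => //.
  have [_ yrk ltk below_k] := yP k.
  case: (ltngtP k j) => [kj|jk|/val_inj ->]; last first.
  - by constructor 2.
  - case: (ltrP 0 (r j * r k)) => [rjk|rjk].
      have := below_k j jk rjk => lt_jk.
      by constructor 3; split=> //; apply: le_lt_trans vr lt_jk.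
    constructor 1; rewrite ltNge; apply/negP; rewrite le_eqVlt => /orP[|ykj].
      rewrite eq_sym mulf_eq0 (negbTE (ordered_root_neq0 j)) orbF => /eqP yk0.
      by move: yrk; rewrite yk0 mul0r ltxx.
    by move: rjk; rewrite leNgt mulrC (mulr_gt0_trans _ ykj) // mulrC.
  - case: (ltrP 0 (r k * r j)) => [rkj|rkj].
      have lt_kj := euler_root_lt kj rkj.
      by constructor 2; split; [exact: lt_trans lt_kj yv|exact: lt_trans lt_kj ltj].
    constructor 1; rewrite ltNge; apply/negP; rewrite le_eqVlt => /orP[|ykj].
      rewrite eq_sym mulf_eq0 (negbTE (ordered_root_neq0 j)) orbF => /eqP yk0.
      by move: yrk; rewrite yk0 mul0r ltxx.
    by move: rkj; rewrite leNgt (mulr_gt0_trans _ ykj) // mulrC.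
have : (Q.[u] * G.[r j]) * (G.[v] * G.[r j]) < 0 by rewrite pmulr_llt0.
rewrite (_ : _ * _ = G.[r j] ^+ 2 * (Q.[u] * G.[v])); last by ring.
by apply: contraTT; rewrite -!leNgt => H; rewrite mulr_ge0 ?sqr_ge0.
Qed.

(** A combination of [Q] and [G] vanishes at both [w] and [- w] as soon as
    [Q.[w] * G.[- w] = G.[w] * Q.[- w]].  When the moduli are exchanged, the
    difference of the two sides changes sign between [y i] and [r i]; there [Q]
    and [G] have opposite signs, so that the combination has positive weights. *)
Lemma opposite_roots_in_segment (i j : 'I_n) :
    (i < j)%N -> r i * r j < 0 -> `|y j| <= `|y i| ->
  exists l w, [/\ 0 < l, w != 0, root (euler l Q) w & root (euler l Q) (- w)].
Proof.
move=> ij rij; have rji := inc ij.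
have [ryi yri lt_i _] := yP i; have [ryj yrj lt_j _] := yP j.
have yi0 : y i != 0 by apply: contraTneq yri => ->; rewrite mul0r ltxx.
have opp_j u : 0 < u * r i -> 0 < - u * r j.
  move=> ui; rewrite mulNr oppr_gt0.
  have : (u * r i) * (r i * r j) < 0 by rewrite pmulr_rlt0.
  rewrite (_ : _ * _ = r i ^+ 2 * (u * r j)); last by ring.
  by apply: contraTT; rewrite -!leNgt => H; rewrite mulr_ge0 ?sqr_ge0.
rewrite le_eqVlt => /orP[/eqP E|lt_ji].
  exists 1, (y i); split=> //.
  have -> : - y i = y j; last by [].
  have := mulr_gt0_trans (opp_j _ yri) _; rewrite mulrC in yrj.
  move=> /(_ _ yrj); move: E.
  by case: (ltrgt0P (y i)); case: (ltrgt0P (y j)) => ? ? ? H; nra.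
have rii : 0 < r i * r i by rewrite -expr2 lt_def sqr_ge0 sqrf_eq0 ordered_root_neq0.
pose F := Q * (G \Po (- 'X)) - G * (Q \Po (- 'X)).
have HF x : F.[x] = Q.[x] * G.[- x] - G.[x] * Q.[- x].
  by rewrite /F !hornerE !horner_comp !hornerE.
have Fneg : F.[y i] * F.[r i] < 0.
  rewrite !HF (eqP ryi) (eqP (ordered_root i)) mul0r subr0 mul0r sub0r.
  rewrite (_ : _ * _ = - ((Q.[y i] * G.[r i]) * (Q.[- r i] * G.[- y i]))); last by ring.
  rewrite oppr_lt0 nmulr_rgt0.
    have le1 := ltW (lt_trans lt_ji lt_i); have le2 := ltW (lt_trans lt_i rji).
    apply: (@opposite_signs_between j); rewrite ?normrN ?opp_j //.
  by apply: (@opposite_signs_between i); rewrite // ?ltW.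
have [w [rw wi yw wr]] := ivt_same_side yri lt_i Fneg.
have QG : Q.[w] * G.[w] < 0 by apply: (@opposite_signs_between i); rewrite // ?ltW.
have D0 : Q.[w] - G.[w] != 0.
  by apply: contraTneq QG => /eqP; rewrite subr_eq0 => /eqP ->;
    rewrite -leNgt -expr2 sqr_ge0.
exists (Q.[w] / (Q.[w] - G.[w])), w; split.
- have : 0 < Q.[w] * (Q.[w] - G.[w]).
    by rewrite mulrBr subr_gt0 (lt_le_trans QG) // -expr2 sqr_ge0.
  move=> H; rewrite -(pmulr_lgt0 _ (_ : 0 < (Q.[w] - G.[w]) ^+ 2)).
    by rewrite expr2 mulrA divfK.
  by rewrite lt_def sqr_ge0 sqrf_eq0 D0.
- by apply: contraTneq wi => ->; rewrite mul0r ltxx.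
- by rewrite rootE horner_euler; apply/eqP; field.
- rewrite rootE horner_euler; apply/eqP.
  move: rw; rewrite rootE HF => /eqP rw.
  rewrite (_ : _ + _ = (Q.[w] * G.[- w] - G.[w] * Q.[- w]) / (Q.[w] - G.[w])).
    by rewrite rw mul0r.
  by field.
Qed.

End EulerRoots.

Section EulerOrder.
Variable R : realType.

(** A change in the order of moduli would produce an opposite pair of roots for
    some hyperbolic polynomial with the sign pattern of [Q]. *)
Lemma euler_order (Q : {poly R}) t o : (0 < size t)%N -> has_signs Q t ->
  ~~ has_configuration (rev t) -> defines_order Q o -> defines_order (euler 1 Q) o.
Proof.
move=> t0 QS noconf ord; have sQ : (0 < size Q)%N by rewrite QS.1.
have Q0 : Q`_0 != 0 by apply: has_signs_neq0 QS _.
have hQ : hyperbolic Q.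
  by apply: defines_order_hyperbolic ord; rewrite -size_poly_gt0.
have GS := euler_signs ler01 QS.
move: ord => /defines_orderP[r [EQ inc lett]].
have [y yP] := fin_all_exists (euler_root_below EQ inc Q0).
have size_G : size (euler 1 Q) = size Q by rewrite GS.1 QS.1.
apply/defines_orderP; exists y; split.
- exact: euler_split yP size_G.
- move=> i j ij.
  case: (ltrP 0 (r i * r j)) => [rij|rij]; first exact: euler_root_lt yP _ _ ij rij.
  rewrite ltNge; apply: contra noconf => yij.
  have [|l [w [l0 w0 rw rNw]]] :=
    opposite_roots_in_segment EQ inc Q0 yP size_G ij _ yij.
    rewrite lt_neqAle rij andbT mulf_eq0 negb_or.
    by rewrite (ordered_root_neq0 EQ Q0) (ordered_root_neq0 EQ Q0).
  apply: opposite_roots_configuration w0 rw rNw.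
    exact: hyperbolic_addXderiv.
  exact: euler_signs (ltW l0) QS.
- by move=> i; rewrite (letter_of_euler_root yP).
Qed.

End EulerOrder.

(** * Polynomials with one dominant monomial on each of suitable circles *)

Lemma size_canonical_order s : size (canonical_order s) = (size s).-1.
Proof.
rewrite /canonical_order -[in RHS](size_rev s).
by case: (rev s) => //= a t; rewrite size_pairmap.
Qed.

Lemma nth_canonical_order s i : (i.+1 < size s)%N ->
  nth LetP (canonical_order s) i =
  letter_of_signs (nth Plus (rev s) i) (nth Plus (rev s) i.+1).
Proof.
rewrite /canonical_order -(size_rev s); case: (rev s) => //= a t it.
by rewrite (nth_pairmap Plus).
Qed.

Lemma fin_eventually (I : finType) (P : I -> nat -> Prop) :
    (forall i, exists N, forall m, (N <= m)%N -> P i m) ->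
  exists N, forall m, (N <= m)%N -> forall i, P i m.
Proof.
move=> /fin_all_exists[N NP]; exists (\max_i N i)%N => m Nm i.
exact/NP/(leq_trans (leq_bigmax i)).
Qed.

Section Dominance.
Variable R : realType.
Implicit Types (P Q : {poly R}) (s t : seq sign) (o : seq letter).

Lemma eventually_mulrn_gt (a b : R) : 0 < a ->
  exists N, forall m, (N <= m)%N -> b < m%:R * a.
Proof.
move=> a0; exists (Num.bound (`|b| / a)) => m Nm.
have /archi_boundP : 0 <= `|b| / a by rewrite divr_ge0 // ltW.
rewrite ltr_pdivrMr // => lt_b; apply: le_lt_trans (ler_norm b) _.
by apply: lt_le_trans lt_b _; rewrite ler_pM2r // ler_nat.
Qed.

Lemma eventually_ltXn (a b M C : R) : 0 < a -> a < b -> 0 < C ->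
  exists N, forall m, (N <= m)%N -> M * a ^+ m < C * b ^+ m.
Proof.
move=> a0 ab C0; have d0 : 0 < b / a - 1 by rewrite subr_gt0 ltr_pdivlMr ?mul1r.
have [N NP] := eventually_mulrn_gt M (mulr_gt0 C0 d0).
exists N => m /NP lt_M.
have bern : m%:R * (b / a - 1) <= (b / a) ^+ m.
  apply: le_trans (_ : 1 + m%:R * (b / a - 1) <= _); first by rewrite lerDr.
  elim: m {lt_M} => [|m IH]; first by rewrite mul0r addr0 expr0.
  have ba : 0 <= b / a by rewrite divr_ge0 ?ltW // (lt_trans a0).
  rewrite exprS; apply: le_trans (ler_wpM2l ba IH).
  rewrite -natr1 mulrDl mul1r -subr_ge0.
  have -> : b / a * (1 + m%:R * (b / a - 1)) -
     (1 + (m%:R * (b / a - 1) + (b / a - 1))) = m%:R * (b / a - 1) ^+ 2 by ring.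
  by rewrite mulr_ge0 ?sqr_ge0.
have -> : b ^+ m = (b / a) ^+ m * a ^+ m by rewrite -exprMn divfK ?gt_eqF.
rewrite mulrA ltr_pM2r ?exprn_gt0 //; apply: lt_le_trans lt_M _.
by rewrite mulrCA ler_pM2l.
Qed.

Lemma sum_dominant n (k : 'I_n.+1) (a : 'I_n.+1 -> R) : 0 < a k ->
    (forall j, j != k -> n.+1%:R * `|a j| < a k) ->
  0 < \sum_j a j.
Proof.
move=> ak dom; rewrite (bigD1 k) //= -ltrBlDl sub0r.
have N0 : 0 < n.+1%:R :> R by rewrite ltr0Sn.
apply: lt_le_trans (_ : \sum_(j | j != k) - (a k / n.+1%:R) <= _).
  rewrite sumr_const cardC1 card_ord mulNrn ltrN2 -(mulr_natr (a k / _)).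
  by rewrite -mulrA gtr_pMr // mulrC ltr_pdivrMr // mul1r ltr_nat.
apply: ler_sum => j /dom dom_j; rewrite lerNl.
apply: le_trans (_ : `|a j| <= _); first by rewrite -normrN ler_norm.
by rewrite ler_pdivlMr // mulrC ltW.
Qed.

(** When the [k]-th monomial dominates on the circle of radius [rho k], the
    signs at [rho k] and [- rho k] locate exactly one root between consecutive
    circles, on the side prescribed by the canonical order. *)
Lemma canonical_order_of_dominant Q s (rho : nat -> R) :
    (0 < size s)%N -> has_signs Q (rev s) ->
    (forall k, 0 < rho k) -> (forall k, rho k < rho k.+1) ->
    (forall k (e : R), (k < size s)%N -> e ^+ 2 = 1 ->
      0 < e ^+ k * (Q`_k * Q.[e * rho k])) ->
  defines_order Q (canonical_order s).
Proof.
move=> s0 QS rho0 rhoS dom.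
have szQ : size Q = size s by rewrite QS.1 size_rev.
have rho_le i j : (i <= j)%N -> rho i <= rho j.
  by elim: j => [|j IH]; rewrite leq_eqVlt => /orP[/eqP -> //|//] => /IH H;
    apply: le_trans H (ltW _).
have szo : (size (canonical_order s)).+1 = size s.
  by rewrite size_canonical_order prednK.
have rootP (i : 'I_(size (canonical_order s))) : exists z,
    [/\ root Q z, rho i < `|z|, `|z| < rho i.+1
      & letter_of_root z = nth LetP (canonical_order s) i].
  have is1 : (i.+1 < size s)%N by rewrite -szo ltnS ltn_ord.
  rewrite nth_canonical_order // /letter_of_signs.
  rewrite -[_ == _]negbK (has_signs_neq QS) ?szQ ?(ltnW is1) //.
  (* On the half-line of sign [e] the signs of [Q] at the two circles are
     opposite. *)
  have [e [e2 ne eQ elet]] : exists e : R, [/\ e ^+ 2 = 1, `|e| = 1,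
      e * (Q`_i * Q`_i.+1) < 0 & forall x, 0 < x * e -> letter_of_root x =
        if ~~ (Q`_i * Q`_i.+1 < 0) then LetN else LetP].
    case: ltrP => sg; [exists 1 | exists (-1)].
      by rewrite expr1n normr1 mul1r; split=> // x; rewrite mulr1 /letter_of_root => ->.
    rewrite sqrrN expr1n normrN normr1 mulN1r oppr_lt0; split=> // [|x].
      rewrite lt_neqAle sg andbT eq_sym mulf_eq0 negb_or.
      by rewrite !(has_signs_neq0 QS) // szQ // ltnW.
    by rewrite mulrN1 oppr_gt0 /letter_of_root => /lt_gtF ->.
  have d1 := dom i e (ltnW is1) e2; have d2 := dom i.+1 e is1 e2.
  have er j : `|e * rho j| = rho j by rewrite normrM ne mul1r gtr0_norm.
  have [||| z [rz zs zl zr]] := @ivt_same_side _ Q (e * rho i) (e * rho i.+1).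
  - by rewrite mulrACA -expr2 e2 mul1r mulr_gt0.
  - by rewrite !er.
  - have := mulr_gt0 d1 d2; set x := Q.[_]; set x' := Q.[_].
    have -> : e ^+ i * (Q`_i * x) * (e ^+ i.+1 * (Q`_i.+1 * x')) =
       (e ^+ i * e ^+ i) * ((e * (Q`_i * Q`_i.+1)) * (x * x')) by rewrite exprS; ring.
    by rewrite -exprMn -expr2 e2 expr1n mul1r nmulr_rgt0.
  exists z; rewrite !er in zl zr; split=> //.
  by apply: elet; move: zs; rewrite mulrA pmulr_lgt0.
have [z zP] := fin_all_exists rootP.
have zinc (i j : 'I_(size (canonical_order s))) : (i < j)%N -> `|z i| < `|z j|.
  move=> ij; have [_ _ lt_i _] := zP i; have [_ lt_j _ _] := zP j.
  exact: lt_trans lt_i (le_lt_trans (rho_le _ _ ij) lt_j).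
apply/defines_orderP; exists z; split=> // [|i]; last by have [] := zP i.
apply: split_of_roots => [|i|i j Ez]; first by rewrite szQ szo.
- by have [] := zP i.
- by apply: val_inj; case: (ltngtP i j) => // /zinc; rewrite Ez ltxx.
Qed.

(** The sequence [(j + 1) r^j] peaks at [j = k] exactly when [r] is between
    [k / (k + 1)] and [(k + 1) / (k + 2)]; this is the mediant of the two. *)
Definition peak_ratio (k : nat) : R := (k.*2.+1)%:R / (k.*2.+3)%:R.

Lemma peak_ratio_gt0 k : 0 < peak_ratio k.
Proof. by rewrite divr_gt0 ?ltr0Sn. Qed.

Lemma peak_ratio_lt k : peak_ratio k < peak_ratio k.+1.
Proof.
rewrite /peak_ratio ltr_pdivrMr ?ltr0Sn // mulrAC ltr_pdivlMr ?ltr0Sn //.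
by rewrite -!natrM ltr_nat; nia.
Qed.

Lemma peak_ratioP k j : j != k ->
  j.+1%:R * peak_ratio k ^+ j < k.+1%:R * peak_ratio k ^+ k.
Proof.
set r := peak_ratio k; have r0 : 0 < r := peak_ratio_gt0 k.
pose f i : R := i.+1%:R * r ^+ i.
have fE i : f i.+1 = i.+2%:R * r * r ^+ i by rewrite /f exprS mulrA.
have up i : (i < k)%N -> f i < f i.+1.
  move=> ik; rewrite fE ltr_pM2r ?exprn_gt0 // /r /peak_ratio mulrA.
  by rewrite ltr_pdivlMr ?ltr0Sn // -!natrM ltr_nat; nia.
have down i : (k <= i)%N -> f i.+1 < f i.
  move=> ik; rewrite fE ltr_pM2r ?exprn_gt0 // /r /peak_ratio mulrA.
  by rewrite ltr_pdivrMr ?ltr0Sn // -!natrM ltr_nat; nia.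
have ups m i : (i + m.+1 <= k)%N -> f i < f (i + m.+1)%N.
  elim: m => [|m IH] im; first by rewrite addn1; apply: up; lia.
  by rewrite addnS; apply: lt_trans (up _ _); [apply: IH|]; lia.
have downs m i : (k <= i)%N -> f (i + m.+1)%N < f i.
  move=> ki; elim: m => [|m IH]; first by rewrite addn1; apply: down.
  by rewrite addnS; apply: lt_trans IH; apply: down; lia.
rewrite neq_ltn -!/(f _) => /orP[jk|kj].
  by have := ups (k - j).-1 j; rewrite (_ : j + _ = k)%N; [apply|]; lia.
by have := downs (j - k).-1 k; rewrite (_ : k + _ = j)%N; [apply|]; lia.
Qed.

Lemma coef_iter_euler m Q j :
  (iter m (euler 1) Q)`_j = j.+1%:R ^+ m * Q`_j.
Proof.
elim: m => [|m IH]; first by rewrite mul1r.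
by rewrite iterS coef_euler IH mul1r nat1r exprS mulrA.
Qed.

Lemma iter_euler_signs m Q t : has_signs Q t -> has_signs (iter m (euler 1) Q) t.
Proof. by move=> QS; elim: m => //= m; apply: euler_signs. Qed.

(** Iterating [Q + X Q'] multiplies the [j]-th coefficient by a high power of
    [j + 1]; as [log (j + 1)] is strictly concave, every monomial ends up
    dominating on some circle. *)
Lemma iter_euler_canonical Q s : (0 < size s)%N -> has_signs Q (rev s) ->
  exists m, defines_order (iter m (euler 1) Q) (canonical_order s).
Proof.
move=> s0 QS; have szQ : size Q = size s by rewrite QS.1 size_rev.
have [n sn] : exists n, size s = n.+1 by exists (size s).-1; rewrite prednK.
have Qk0 (k : 'I_n.+1) : 0 < Q`_k ^+ 2.
  by rewrite lt_def sqr_ge0 sqrf_eq0 (has_signs_neq0 QS) // szQ sn.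
have [k | N NP] := @fin_eventually ('I_n.+1 * 'I_n.+1)%type (fun p m => p.2 != p.1 ->
    n.+1%:R * `|Q`_p.1 * Q`_p.2| * (p.2.+1%:R * peak_ratio p.1 ^+ p.2) ^+ m <
    Q`_p.1 ^+ 2 * (p.1.+1%:R * peak_ratio p.1 ^+ p.1) ^+ m).
  case: (eqVneq k.2 k.1) => [E|/peak_ratioP H]; first by exists 0%N.
  have [|N NP] := eventually_ltXn (n.+1%:R * `|Q`_k.1 * Q`_k.2|) _ H (Qk0 k.1).
    by rewrite mulr_gt0 ?ltr0Sn ?exprn_gt0 ?peak_ratio_gt0.
  by exists N => m /NP.
exists N.+1; apply: (@canonical_order_of_dominant _ _ (fun k => peak_ratio k ^+ N.+1)).
- by [].
- exact: iter_euler_signs.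
- by move=> k; rewrite exprn_gt0 ?peak_ratio_gt0.
- move=> k; rewrite ltr_pXn2r ?nnegrE ?ltW ?peak_ratio_gt0 //.
  exact: peak_ratio_lt.
move=> k e; rewrite sn => kn e2.
rewrite coef_iter_euler horner_coef.
rewrite (iter_euler_signs N.+1 QS).1 size_rev sn.
pose g (j : nat) := j.+1%:R * peak_ratio k ^+ j.
have -> : e ^+ k * (k.+1%:R ^+ N.+1 * Q`_k * \sum_(i < n.+1)
     (iter N.+1 (euler 1) Q)`_i * (e * peak_ratio k ^+ N.+1) ^+ i) =
  k.+1%:R ^+ N.+1 * \sum_(i < n.+1) e ^+ (k + i) * (Q`_k * Q`_i) * g i ^+ N.+1.
  rewrite -[_ * Q`_k * _]mulrA mulrCA; congr (_ * _).
  rewrite mulrA mulr_sumr; apply: eq_bigr => i _.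
  rewrite coef_iter_euler [(e * _) ^+ i]exprMn exprAC /g [(_ * _) ^+ N.+1]exprMn.
  by rewrite exprD; ring.
rewrite pmulr_rgt0 ?exprn_gt0 ?ltr0Sn //.
have eX i : `|e ^+ i| = 1.
  by apply/eqP; rewrite normrX -(@sqrp_eq1 _ (`|e| ^+ i)) ?exprn_ge0 //
    -exprM mulnC exprM real_normK ?num_real // e2 expr1n.
have g0 j : 0 < g j by rewrite mulr_gt0 ?ltr0Sn ?exprn_gt0 ?peak_ratio_gt0.
pose k' := Ordinal kn.
have Ek : e ^+ (k' + k') = 1 by rewrite addnn -mul2n exprM e2 expr1n.
apply: (@sum_dominant _ k'); rewrite Ek mul1r -expr2.
  by apply: mulr_gt0; [exact: (Qk0 k') | exact/exprn_gt0/g0].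
move=> j jk; rewrite normrM normrM eX mul1r.
rewrite [`|g j ^+ _|]gtr0_norm ?exprn_gt0 // mulrA.
exact: (NP N.+1 (leqnSn N) (k', j) jk).
Qed.

End Dominance.

(** * Lengthening a sign pattern by a very small or a very large root *)

Lemma canonical_order_cons b a s : canonical_order (b :: a :: s) =
  rcons (canonical_order (a :: s)) (letter_of_signs a b).
Proof.
rewrite /canonical_order !rev_cons; case: (rev s) => //= c t.
by rewrite -!cats1 pairmap_cat /= last_cat.
Qed.

Lemma canonical_order_rcons s a b : canonical_order (rcons (rcons s a) b) =
  letter_of_signs b a :: canonical_order (rcons s a).
Proof. by rewrite /canonical_order !rev_rcons. Qed.

Section Lengthening.
Variable R : realType.
Implicit Types (P Q : {poly R}) (s t : seq sign) (o : seq letter) (rs : seq R).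

Lemma realizesP o s : (0 < size s)%N ->
  realizes R o s <-> exists2 Q : {poly R}, has_signs Q (rev s) & defines_order Q o.
Proof.
move=> s0; split=> [[Q [_ /defines_sign_patternP QS Qo]]|[Q QS Qo]].
  by exists Q.
exists Q; split=> //; last exact/defines_sign_patternP.
apply: defines_order_hyperbolic Qo.
by rewrite -size_poly_gt0 QS.1 size_rev.
Qed.

Lemma defines_order_prod (c : R) rs : sorted (fun x y : R => `|x| < `|y|) rs ->
  defines_order (c *: \prod_(x <- rs) ('X - x%:P)) (map (@letter_of_root R) rs).
Proof. by exists rs; rewrite lead_coefZ_prod. Qed.

Lemma signr_sqr (a : sign) : signr R a ^+ 2 = 1.
Proof. by case: a; rewrite /= ?sqrrN expr1n. Qed.

Lemma signr_norm (a : sign) : `|signr R a| = 1.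
Proof. by case: a; rewrite /= ?normrN normr1. Qed.

Lemma signr_perturb (a : sign) (x y u : R) :
  0 < signr R a * x -> `|u * y| < `|x| -> 0 < signr R a * (x - u * y).
Proof.
case: a => /=; rewrite ?mul1r ?mulN1r ?oppr_gt0 => x0.
  by rewrite (gtr0_norm x0) ltr_norml subr_gt0 => /andP[].
by rewrite (ltr0_norm x0) ltr_norml opprK subr_lt0 => /andP[].
Qed.

(** A root of this sign produces, by Vieta's rule, the transition from [a]
    to [b]. *)
Definition root_sign (a b : sign) : R := if a == b then -1 else 1.

Lemma letter_of_root_sign (a b : sign) (x : R) : 0 < x ->
  letter_of_root (root_sign a b * x) = letter_of_signs a b.
Proof.
rewrite /letter_of_root /letter_of_signs /root_sign => x0.
by case: eqP => _; rewrite ?mulN1r ?oppr_gt0 ?mul1r ?x0 ?(lt_gtF x0).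
Qed.

Lemma root_sign_norm (a b : sign) (x : R) : 0 < x -> `|root_sign a b * x| = x.
Proof.
move=> x0; rewrite normrM [`|x|]gtr0_norm // /root_sign.
by case: ifP; rewrite ?normrN normr1 mul1r.
Qed.

Lemma signr_root_sign (a b : sign) (x c : R) :
  0 < x -> 0 < signr R a * c -> 0 < signr R b * - (root_sign a b * x * c).
Proof.
rewrite /root_sign => x0; case: a; case: b => /=;
  by rewrite ?mulN1r ?mul1r ?mulNr ?opprK ?oppr_gt0 ?pmulr_rgt0 ?pmulr_rlt0.
Qed.

Lemma letter_of_signsC (a b : sign) : letter_of_signs a b = letter_of_signs b a.
Proof. by rewrite /letter_of_signs eq_sym. Qed.

(** For [m] large, [1 / m] is a small perturbation of the coefficients and is
    smaller than the moduli of the roots, while [m] exceeds them. *)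
Lemma eventually_small Q rs : (forall j, (j < size Q)%N -> Q`_j != 0) ->
    (forall x, x \in rs -> x != 0) ->
  exists2 m, 0 < m & [/\
    forall i j, (j < size Q)%N -> (i < size Q)%N -> `|Q`_i| < m * `|Q`_j|,
    forall x, x \in rs -> m^-1 < `|x| & forall x, x \in rs -> `|x| < m].
Proof.
move=> Q0 rs0.
have [|N NP] := @fin_eventually ('I_(size Q) * 'I_(size Q))%type
    (fun p m => `|Q`_p.1| < m%:R * `|Q`_p.2|).
  by move=> [i j]; apply: eventually_mulrn_gt; rewrite normr_gt0 Q0.
have [|N' NP'] := @fin_eventually 'I_(size rs) (fun i m =>
    1 < m%:R * `|rs`_i| ).
  by move=> i; apply: eventually_mulrn_gt; rewrite normr_gt0 rs0 // mem_nth.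
have [|N'' NP''] := @fin_eventually 'I_(size rs) (fun i m =>
    `|rs`_i| < m%:R * (1 : R)).
  by move=> i; apply: eventually_mulrn_gt.
set m := (N + N' + N'').+1.
exists m%:R; first by rewrite ltr0Sn.
split=> [i j jQ iQ|x|x].
- by apply: (NP m _ (Ordinal iQ, Ordinal jQ)); rewrite /m; lia.
- case/(nthP 0) => i irs <-; rewrite -[_^-1]mul1r ltr_pdivrMr ?ltr0Sn // mulrC.
  by apply: (NP' m _ (Ordinal irs)); rewrite /m; lia.
- case/(nthP 0) => i irs <-; rewrite -[m%:R]mulr1.
  by apply: (NP'' m _ (Ordinal irs)); rewrite /m; lia.
Qed.

Lemma defines_order_roots_neq0 Q t rs : (0 < size t)%N -> has_signs Q t ->
    Q = lead_coef Q *: \prod_(x <- rs) ('X - x%:P) ->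
  forall x, x \in rs -> x != 0.
Proof.
move=> t0 QS EQ x xrs; apply: contraTneq xrs => ->.
rewrite -root_prod_XsubC; apply/negP => r0.
have : root Q 0 by rewrite EQ /root hornerZ (eqP r0) mulr0.
by apply/negP; rewrite rootE horner_coef0 (has_signs_neq0 QS) // QS.1.
Qed.

(** The new factor is [1 - u X] with [u] small: it perturbs the coefficients and
    adds [- u] times the leading one, and its root [1 / u] is the largest. *)
Lemma realizes_cons o b a s : realizes R o (a :: s) ->
  realizes R (rcons o (letter_of_signs a b)) (b :: a :: s).
Proof.
move=> /realizesP - /(_ isT)[Q QS [rs [EQ srt <-]]]; apply/realizesP => //.
have szQ : size Q = (size s).+1 by rewrite QS.1 size_rev.
have t0 : (0 < size (rev (a :: s)))%N by rewrite size_rev.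
have rs0 := defines_order_roots_neq0 t0 QS EQ.
have [m m0 [mQ _ m_gt]] := eventually_small (fun j => has_signs_neq0 QS) rs0.
have mi0 : 0 < m^-1 by rewrite invr_gt0.
pose u := root_sign a b * m^-1; pose v := root_sign a b * m.
have uv : u * v = 1.
  rewrite /u /v mulrACA mulVf ?gt_eqF // mulr1 /root_sign.
  by case: ifP; rewrite ?mulrNN mulr1.
pose Q' := Q - u *: ('X * Q).
have EQ' : Q' = (- u * lead_coef Q) *: \prod_(x <- rcons rs v) ('X - x%:P).
  rewrite -cats1 big_cat big_seq1 /= /Q' {1 2}EQ.
  set p := \prod_(x <- rs) _; rewrite -!mul_polyC (polyCM (- u)) (polyCN u).
  transitivity ((lead_coef Q)%:P * p * ((u * v)%:P - u%:P * 'X)).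
    by rewrite uv; ring.
  by rewrite (polyCM u v); ring.
exists Q'; last first.
  rewrite EQ' -(letter_of_root_sign a b m0) -map_rcons; apply: defines_order_prod.
  case: rs srt m_gt {EQ EQ' rs0} => //= x rs srt m_gt.
  rewrite rcons_path srt /= root_sign_norm //.
  by apply: m_gt; rewrite mem_last.
have coefQ' j : Q'`_j = Q`_j - u * (if j is i.+1 then Q`_i else 0).
  by rewrite /Q' coefB coefZ coefXM; case: j.
have sg : forall j, (j < (size s).+2)%N ->
    0 < signr R (nth Plus (rev [:: b, a & s]) j) * Q'`_j.
  move=> j; rewrite coefQ' rev_cons nth_rcons size_rev /= ltnS leq_eqVlt orbC.
  case/orP => [js|/eqP ->].
    rewrite js; apply: signr_perturb; first by apply: QS.2; rewrite size_rev.
    rewrite normrM root_sign_norm // ltr_pdivrMl //.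
    case: j js => [|j] js; first by rewrite normr0 mulr_gt0 // normr_gt0
      (has_signs_neq0 QS) // szQ.
    by apply: mQ; rewrite szQ // ltnW.
  rewrite ltnn eqxx nth_default ?szQ // sub0r; apply: signr_root_sign => //.
  have := QS.2 (size s); rewrite size_rev rev_cons nth_rcons size_rev ltnn eqxx.
  by apply.
split=> //; last by rewrite size_rev.
rewrite size_rev; apply/eqP; rewrite eqn_leq; apply/andP; split.
  apply/leq_sizeP => -[|j] //= js; rewrite coefQ' !nth_default ?szQ //; last exact: ltnW.
  by rewrite mulr0 subr0.
rewrite ltnNge; apply/negP => /leq_sizeP/(_ _ (leqnn _)) Qs.
by have := sg _ (leqnn _); rewrite Qs mulr0 ltxx.
Qed.

(** The new factor is [X - u] with [u] small: it shifts and perturbs the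
    coefficients, adds [- u] times the constant one, and [u] is the smallest
    root. *)
Lemma realizes_rcons o s a b : realizes R o (rcons s a) ->
  realizes R (letter_of_signs b a :: o) (rcons (rcons s a) b).
Proof.
move=> /realizesP; rewrite size_rcons => /(_ isT)[Q QS [rs [EQ srt <-]]].
apply/realizesP; first by rewrite size_rcons.
have szQ : size Q = (size s).+1 by rewrite QS.1 size_rev size_rcons.
have t0 : (0 < size (rev (rcons s a)))%N by rewrite size_rev size_rcons.
have rs0 := defines_order_roots_neq0 t0 QS EQ.
have [m m0 [mQ m_lt _]] := eventually_small (fun j => has_signs_neq0 QS) rs0.
have mi0 : 0 < m^-1 by rewrite invr_gt0.
pose u := root_sign a b * m^-1; pose Q' := 'X * Q - u *: Q.
have EQ' : Q' = lead_coef Q *: \prod_(x <- u :: rs) ('X - x%:P).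
  rewrite big_cons /Q' {1 2}EQ.
  set p := \prod_(x <- rs) _; rewrite -!mul_polyC; ring.
exists Q'; last first.
  rewrite EQ' letter_of_signsC -(letter_of_root_sign a b mi0) -map_cons.
  apply: defines_order_prod.
  case: rs srt m_lt {EQ EQ' rs0} => //= x rs srt m_lt.
  by rewrite srt andbT root_sign_norm // m_lt // mem_head.
have QX : Q' = ('X - u%:P) * Q by rewrite /Q' mulrBl mul_polyC.
split.
  rewrite QX size_monicM ?monicXsubC // ?size_XsubC; last by rewrite -size_poly_gt0 szQ.
  by rewrite szQ size_rev !size_rcons.
move=> j; rewrite size_rev !size_rcons ltnS rev_rcons /Q' coefB coefZ coefXM.
case: j => [|j] /= js.
  rewrite sub0r; apply: signr_root_sign => //.
  by have := QS.2 0%N t0; rewrite rev_rcons.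
have jQ : (j < size Q)%N by rewrite szQ.
apply: signr_perturb; first by apply: QS.2; rewrite -QS.1.
rewrite normrM root_sign_norm // ltr_pdivrMl //.
have [j1|j1] := ltnP j.+1 (size Q); first exact: mQ.
by rewrite [Q`_j.+1]nth_default // normr0 mulr_gt0 // normr_gt0 (has_signs_neq0 QS).
Qed.

Lemma realizes_canonical_order s : (0 < size s)%N ->
  realizes R (canonical_order s) s.
Proof.
case: s => // a s _; elim: s a => [|a' s IH] a; last first.
  by rewrite canonical_order_cons; apply: realizes_cons.
apply/realizesP => //; exists (signr R a)%:P.
  have c0 : signr R a != 0 by case: a; rewrite ?oppr_eq0 oner_eq0.
  split=> [|[|j] //]; first by rewrite size_polyC c0.
  by rewrite coefC /= -expr2 lt_def sqr_ge0 sqrf_eq0 c0.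
exists [::]; split=> //.
by rewrite big_nil lead_coefC alg_polyC.
Qed.

Definition realized_noncanonically s :=
  exists2 o, o <> canonical_order s & realizes R o s.

Lemma noncanonical_cons b s : (0 < size s)%N ->
  realized_noncanonically s -> realized_noncanonically (b :: s).
Proof.
case: s => // a s _ [o No ro]; exists (rcons o (letter_of_signs a b)).
  by rewrite canonical_order_cons => /rcons_inj[].
exact: realizes_cons.
Qed.

Lemma noncanonical_rcons b s : (0 < size s)%N ->
  realized_noncanonically s -> realized_noncanonically (rcons s b).
Proof.
case/lastP: s => // s a _ [o No ro]; exists (letter_of_signs b a :: o).
  by rewrite canonical_order_rcons => -[].
exact: realizes_rcons.
Qed.

Lemma noncanonical_infix s' s : (0 < size s')%N -> infix s' s ->
  realized_noncanonically s' -> realized_noncanonically s.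
Proof.
move=> s'0 /infixP[p [q ->]] H.
have {H} : realized_noncanonically (s' ++ q).
  elim/last_ind: q => [|q b IH]; first by rewrite cats0.
  by rewrite -rcons_cat; apply: noncanonical_rcons; rewrite // size_cat addn_gt0 s'0.
elim: p => //= b p IH H; apply: noncanonical_cons; last exact: IH.
by rewrite !size_cat addn_gt0 (addn_gt0 (size s')) s'0 orbT.
Qed.

Definition opp_sign (a : sign) : sign := sign_of_bool (~~ bool_of_sign a).
Definition mul_sign (a b : sign) : sign := if b is Plus then a else opp_sign a.

(** With [e = 1] or [e = -1], the polynomial [c (X - 2 e) (X + 3 e) (X + 4 e)]
    has coefficients [c, 5 c e, - 2 c, - 24 c e].  Its root of smallest modulus
    is the only one of its sign, which in the canonical order is in the
    middle. *)
Lemma noncanonical_window (c e : sign) :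
  realized_noncanonically
    [:: c; mul_sign c e; opp_sign c; opp_sign (mul_sign c e)].
Proof.
pose x := signr R e; pose rs := [:: 2 * x; - (3 * x); - (4 * x)].
exists (map (@letter_of_root R) rs).
  rewrite /rs /x /letter_of_root; clear rs x.
  case: c; case: e; rewrite /= ?mulr1 ?mulrN1 ?opprK;
    by rewrite ?oppr_gt0 !ltr0n !ltrn0.
apply/realizesP => //; exists (signr R c *: \prod_(y <- rs) ('X - y%:P)); last first.
  apply: defines_order_prod; rewrite /= !normrN !normrM signr_norm.
  by rewrite !mulr1 !normr_nat !ltr_nat.
have x2 : x ^+ 2 = 1 by apply: signr_sqr.
have c0 : signr R c != 0 by case: c; rewrite ?oppr_eq0 oner_eq0.
have -> : signr R c *: \prod_(y <- rs) ('X - y%:P) =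
    Poly [:: - 24 * (signr R c * x); - 2 * signr R c; 5 * (signr R c * x);
             signr R c].
  rewrite /= !cons_poly_def mul0r add0r /rs !big_cons big_nil mulr1 -mul_polyC.
  have X2 : x%:P ^+ 2 = 1 :> {poly R} by rewrite -polyC_exp x2.
  rewrite !(polyCM, polyCN, polyC_natr); set C := (signr R c)%:P.
  transitivity (C * ('X^3 + 5%:R * x%:P * 'X^2 - 2%:R * x%:P ^+ 2 * 'X
     - 24%:R * x%:P * x%:P ^+ 2)); first by ring.
  by rewrite X2; ring.
split=> [|j]; first by rewrite (PolyK (c := 0)).
rewrite coef_Poly /x size_rev {c0 x2}; clear rs x.
case: j => [|[|[|[|]]]] //= _; case: c; case: e => /=;
  rewrite ?mulrN1 ?mulN1r ?mulr1 ?mul1r ?opprK ?mulN1r ?opprK; lra.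
Qed.

End Lengthening.

Theorem theorem7 (R : realType) (d : nat) (hd : (1 <= d)%N)
    (s : (d.+1).-tuple sign) :
  canonical R s <->
  [/\ ~~ infix confA s, ~~ infix confB s, ~~ infix confC s & ~~ infix confD s].
Proof.
have s0 : (0 < size s)%N by rewrite size_tuple.
have -> : [/\ ~~ infix confA s, ~~ infix confB s, ~~ infix confC s
             & ~~ infix confD s] <-> ~~ has_configuration s.
  by rewrite /has_configuration !negb_or; split=> [[-> -> -> ->]|/and4P].
split=> [[_ canon]|noconf].
  have nconf c e : ~~ infix [:: c; mul_sign c e; opp_sign c; opp_sign (mul_sign c e)] s.
    apply/negP => /noncanonical_infix -/(_ R isT (noncanonical_window R c e)).
    by case=> o No /canon.
  by rewrite /has_configuration !negb_or (nconf Plus Plus) (nconf Minus Plus)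
    (nconf Plus Minus) (nconf Minus Minus).
split=> [|o /(realizesP R o s0)[Q QS Qo]]; first exact: realizes_canonical_order.
have t0 : (0 < size (rev s))%N by rewrite size_rev.
have [m ord_m] := iter_euler_canonical s0 QS.
have order_m : defines_order (iter m (euler 1) Q) o.
  elim: m {ord_m} => //= m IH; apply: (euler_order t0) IH.
    exact: iter_euler_signs.
  by rewrite revK.
apply: defines_order_uniq order_m ord_m.
by rewrite -size_poly_gt0 (iter_euler_signs m QS).1.
Qed.
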